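(* Let $d$ be an integer with $|d|>1$ and let $f:S^1\to S^1$ be a continuous map of degree $d$. (1) Every semiconjugacy $h$ from $f$ to $m_d$ is the quotient map of a fixed point of the operator $T_F$ for some lift $F$ of $f$, where $T_F$ is considered either on $\mathcal{H}^+$ or on $\mathcal{H}^-$. (2) If $f$ is assumed to be a covering map, then every semiconjugacy from $f$ to $m_d$ is monotone. (3) If $h_1$ and $h_2$ are semiconjugacies from $f$ to $m_d$, then there exists a unique self-conjugacy $c$ of $m_d$ such that $h_1=c\,h_2$.
   Context: $S^1=\{z\in\mathbb{C}:|z|=1\}$, $\pi_0:\mathbb{R}\to S^1$ is $\pi_0(x)=\exp(2\pi i x)$, and $m_d:S^1\to S^1$ is $m_d(z)=z^d$. A lift of $f$ is a continuous $F:\mathbb{R}\to\mathbb{R}$ with $\pi_0F=f\pi_0$. A semiconjugacy from $f$ to $m_d$ is a continuous map $h:S^1\to S^1$ with $hf=m_dh$ such that the induced map $h_*$ on $H_1(S^1,\mathbb{Z})$ is an isomorphism. Let $\mathcal{H}^{\pm}=\{H:\mathbb{R}\to\mathbb{R}: H\text{ is continuous and }H(x+1)=H(x)\pm1\ \forall x\in\mathbb{R}\}$. For a lift $F$ of $f$, the operator $T_F$ (from $\mathcal{H}^+$ to itself, respectively from $\mathcal{H}^-$ to itself) is $T_F(H)(x)=\frac{H(F(x))}{d}$. The quotient map of $H\in\mathcal{H}^{\pm}$ is the map $h:S^1\to S^1$ with $h\pi_0=\pi_0H$. A map of the circle is monotone if it has a monotone lift (not necessarily strictly). A self-conjugacy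 of $m_d$ is a homeomorphism $c$ of $S^1$ with $c\,m_d=m_d\,c$. *)

(* Defs.v *)
From HB Require Import structures.
From mathcomp Require Import all_boot all_order all_algebra.
From mathcomp Require Import all_classical all_reals topology normedtype trigo.
From mathcomp Require Import complex freeg.
Set Implicit Arguments.
Unset Strict Implicit.
Unset Printing Implicit Defensive.
Import Order.TTheory GRing.Theory Num.Theory numFieldNormedType.Exports.
Local Open Scope classical_set_scope.
Local Open Scope ring_scope.
Local Open Scope complex_scope.
Local Open Scope quotient_scope.

Section Simplex.
Variable R : realType.

Definition simplex_set n : set 'rV[R]_n.+1 :=
  [set t | (forall i, 0 <= t 0 i) /\ \sum_i t 0 i = 1].

Definition simplex n : Type := set_type (@simplex_set n).
HB.instance Definition _ n :=
  Topological.copy (simplex n) (set_type (@simplex_set n)).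

(* (t_0, ..., t_n) |-> (t_0, ..., t_(i-1), 0, t_i, ..., t_n) *)
Definition insert0 n (i : 'I_n.+2) (t : 'rV[R]_n.+1) : 'rV[R]_n.+2 :=
  \row_j oapp (t 0) 0 (unlift i j).

Lemma insert0_simplex n (i : 'I_n.+2) (t : simplex n) :
  simplex_set (insert0 i (val t)).
Proof.
have [t0 t1] : simplex_set (val t) by exact: set_mem (valP t).
split=> [j|]; first by rewrite mxE; case: unliftP => [k|] _ //=.
rewrite -t1 (bigD1_ord i) //= mxE unlift_none /= add0r.
by apply: eq_bigr => k _; rewrite mxE liftK.
Qed.

Definition face n (i : 'I_n.+2) (t : simplex n) : simplex n.+1 :=
  exist _ (insert0 i (val t)) (mem_set (insert0_simplex i t)).

Lemma face_continuous n (i : 'I_n.+2) : continuous (@face n i).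
Proof.
suff ci : continuous (insert0 i : 'rV[R]_n.+1 -> 'rV[R]_n.+2).
  apply: continuous_comp_initial => t.
  apply: (@continuous_comp _ _ _ (val : simplex n -> 'rV[R]_n.+1)) => //.
    exact: (@initial_continuous _ _ (val : set_type (@simplex_set n) -> _)).
  exact: ci.
move=> t A [P tP sPA]; exists (fun _ k => P 0 (fintype.lift i k)).
  by move=> a k; have := tP 0 (fintype.lift i k); rewrite mxE liftK /= (ord1 a).
move=> u /= uP; apply: sPA => a j; have := tP 0 j; rewrite !(ord1 a) !mxE.
by case: unliftP => [k ->|_ /nbhs_singleton //] _; exact: uP.
Qed.
HB.instance Definition _ n (i : 'I_n.+2) :=
  isContinuous.Build (simplex n) (simplex n.+1) (@face n i)
    (@face_continuous n i).

End Simplex.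

Section Chains.
Variables (R : realType) (X : topologicalType).

Definition chain n : Type := {freeg continuousType (simplex R n) X}.
HB.instance Definition _ n := GRing.Lmodule.on (chain n).

Definition boundary n : chain n.+1 -> chain n :=
  fglift (fun s : continuousType (simplex R n.+1) X =>
    \sum_(i < n.+2)
      (-1) ^+ i *: (<< (s \o face i : continuousType _ _) >> : chain n)).

Lemma boundary_additive n : zmod_morphism (@boundary n).
Proof. exact: lift_is_additive. Qed.
HB.instance Definition _ n :=
  GRing.isZmodMorphism.Build (chain n.+1) (chain n) (@boundary n)
    (@boundary_additive n).

Definition is_cycle : {pred chain 1} := [pred c | boundary c == 0].
Lemma is_cycle_closed : zmod_closed is_cycle.
Proof.
split=> [|a b]; first by rewrite inE raddf0.
by rewrite !inE raddfB /= => /eqP-> /eqP->; rewrite subrr.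
Qed.
HB.instance Definition _ :=
  GRing.isZmodClosed.Build (chain 1) is_cycle is_cycle_closed.

Record cycle : Type := Cycle { chain_of : chain 1; _ : chain_of \in is_cycle }.
HB.instance Definition _ := [isSub for chain_of].
HB.instance Definition _ := [Choice of cycle by <:].
HB.instance Definition _ := [SubChoice_isSubZmodule of cycle by <:].

(* The 1-cycles in the image of the boundary map from 2-chains; quotienting the
   group of 1-cycles by them gives the singular homology group H_1(X, Z). *)
Definition is_boundary : {pred cycle} :=
  [pred z | `[< exists b : chain 2, boundary b = val z >]].
Lemma is_boundaryP z :
  reflect (exists b : chain 2, boundary b = val z) (z \in is_boundary).
Proof. exact: asboolP. Qed.

Lemma is_boundary_closed : zmod_closed is_boundary.
Proof.
split=> [|y z]; first by apply/is_boundaryP; exists 0; rewrite !raddf0.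
move=> /is_boundaryP[b bE] /is_boundaryP[c cE]; apply/is_boundaryP.
by exists (b - c); rewrite !raddfB /= bE cE.
Qed.
HB.instance Definition _ :=
  GRing.isZmodClosed.Build cycle is_boundary is_boundary_closed.

Definition H1 : Type := Quotient.quot is_boundary.
HB.instance Definition _ := GRing.Zmodule.on H1.
HB.instance Definition _ := Quotient.on H1.

End Chains.
Arguments is_cycle : clear implicits.
Arguments is_boundary : clear implicits.

Lemma raddf_fglift (K : choiceType) (M N : lmodType int) (g : {additive M -> N})
    (phi : K -> M) (c : {freeg K}) :
  g (fglift phi c) = fglift (g \o phi) c.
Proof.
rewrite -[c]Freeg_enum !fglift_Freeg /prelift raddf_sum /=.
by apply: eq_bigr => -[k s] _ /=; rewrite -[k]intz !scaler_int raddfMz.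
Qed.

Section InducedMap.
Variables (R : realType) (X Y : topologicalType) (f : continuousType X Y).

Definition push n : chain R X n -> chain R Y n :=
  fglift (fun s : continuousType (simplex R n) X =>
    << (f \o s : continuousType _ _) >> : chain R Y n).

Lemma push_additive n : zmod_morphism (@push n).
Proof. exact: lift_is_additive. Qed.
HB.instance Definition _ n :=
  GRing.isZmodMorphism.Build (chain R X n) (chain R Y n) (@push n)
    (@push_additive n).

Lemma boundary_push n (c : chain R X n.+1) :
  boundary (push c) = push (boundary c).
Proof.
rewrite [push c]/push [boundary c]/boundary !raddf_fglift; congr fglift.
apply/funext => s /=.
rewrite [boundary _]liftU scale1r raddf_sum; apply: eq_bigr => i _ /=.
have -> : (-1) ^+ i = ((-1) ^+ i : int)%:~R :> int by rewrite intz.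
rewrite !scaler_int raddfMz /= [push _]liftU scale1r.
by congr (_ *~ _); congr (<< _ >>); apply/continuousEP.
Qed.

Lemma push_cycle_proof (z : cycle R X) : push (val z) \in is_cycle R Y.
Proof. by rewrite inE boundary_push (eqP (valP z)) raddf0. Qed.
Definition push_cycle (z : cycle R X) : cycle R Y := Cycle (push_cycle_proof z).

(* Computed on a representative; H1map_pi shows independence of the choice. *)
Definition H1map : H1 R X -> H1 R Y :=
  fun q => \pi_(H1 R Y) (push_cycle (repr q)).

Lemma H1map_pi (z : cycle R X) :
  H1map (\pi_(H1 R X) z) = \pi_(H1 R Y) (push_cycle z).
Proof.
have /eqP : repr (\pi_(H1 R X) z) = z %[mod H1 R X] by rewrite reprK.
rewrite -Quotient.idealrBE => /is_boundaryP[b bE].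
apply/eqP; rewrite -Quotient.idealrBE; apply/is_boundaryP.
by exists (push b); rewrite boundary_push bE !raddfB.
Qed.

Lemma H1map_additive : zmod_morphism H1map.
Proof.
elim/quotW=> y; elim/quotW=> z; rewrite -raddfB !H1map_pi -raddfB.
by congr (\pi_(H1 R Y) _); apply: val_inj; rewrite /= !raddfB.
Qed.
HB.instance Definition _ :=
  GRing.isZmodMorphism.Build (H1 R X) (H1 R Y) H1map H1map_additive.

End InducedMap.

(* The modulus topology of the complex plane. *)
HB.instance Definition _ (R : realType) := NormedModule.copy R[i] (R[i]^o).

Section Circle.
Variable R : realType.

Definition unit_circle : set R[i] := [set z | `|z| = 1].

Definition circle : Type := set_type unit_circle.
HB.instance Definition _ := Topological.copy circle (set_type unit_circle).

Lemma expi_unit (x : R) :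
  unit_circle (cos (2 * pi * x) +i* sin (2 * pi * x)).
Proof. by rewrite /unit_circle /= normc_def /= cos2Dsin2 sqrtr1. Qed.

(* exp(2 pi i x), the complex exponential being absent from the library *)
Definition pi0 (x : R) : circle :=
  exist _ (cos (2 * pi * x) +i* sin (2 * pi * x)) (mem_set (expi_unit x)).

Lemma power_unit (d : int) (z : circle) : unit_circle (val z ^ d).
Proof.
have z1 : `|val z| = 1 by exact: set_mem (valP z).
by case: d => n; rewrite /unit_circle /= ?normfV normrX z1 expr1n ?invr1.
Qed.

Definition power_map (d : int) (z : circle) : circle :=
  exist _ (val z ^ d) (mem_set (power_unit d z)).

Definition is_lift (F : R -> R) (f : circle -> circle) : Prop :=
  continuous F /\ (forall x, pi0 (F x) = f (pi0 x)).

(* Any two lifts of f differ by an integer constant, so the choice of F does not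
   matter. *)
Definition has_degree (f : circle -> circle) (d : int) : Prop :=
  exists F, is_lift F f /\ forall x, F (x + 1) = F x + d%:~R.

(* H1map h is additive, so it is an isomorphism exactly when it is bijective. *)
Definition semiconjugacy (f g : circle -> circle)
    (h : continuousType circle circle) : Prop :=
  (forall z, h (f z) = g (h z)) /\ bijective (@H1map R _ _ h).

Definition Hplus : set (R -> R) :=
  [set H : R -> R | continuous H /\ forall x, H (x + 1) = H x + 1].
Definition Hminus : set (R -> R) :=
  [set H : R -> R | continuous H /\ forall x, H (x + 1) = H x - 1].

Definition T_op (d : int) (F H : R -> R) : R -> R := fun x => H (F x) / d%:~R.

(* As a relation, h being determined by H since pi0 is onto. *)
Definition quotient_map (H : R -> R) (h : circle -> circle) : Prop :=
  forall x, h (pi0 x) = pi0 (H x).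

Definition monotone_circle_map (h : circle -> circle) : Prop :=
  exists H, is_lift H h /\
    ({homo H : x y / x <= y} \/ {homo H : x y /~ x <= y}).

End Circle.

Section TopologicalMaps.
Variables X Y : topologicalType.

Definition homeomorphism (p : X -> Y) : Prop :=
  continuous p /\
  exists q : Y -> X, [/\ continuous q, cancel p q & cancel q p].

Definition homeomorphism_on (A : set X) (B : set Y) (p : X -> Y) : Prop :=
  [/\ set_fun A B p, {within A, continuous p} &
    exists q : Y -> X, [/\ set_fun B A q, {within B, continuous q},
      {in A, cancel p q} & {in B, cancel q p}]].

Definition evenly_covered (p : X -> Y) (U : set Y) : Prop :=
  exists V : set (set X),
    [/\ \bigcup_(A in V) A = p @^-1` U, trivIset V id &
      forall A, V A -> open A /\ homeomorphism_on A U p].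

Definition covering_map (p : X -> Y) : Prop :=
  continuous p /\ forall y, exists U, [/\ open U, U y & evenly_covered p U].

End TopologicalMaps.

Definition self_conjugacy (R : realType) (d : int) (c : circle R -> circle R) :
    Prop :=
  homeomorphism c /\ forall z, c (power_map d z) = power_map d (c z).

(* Main.v *)
(* Lifting. A continuous K : V -> S^1 is lifted by adding up, along the segment
   from 0 to v, the arcsines of the small turns between the values of K at N
   equally spaced points; N can be chosen locally uniformly in v, and the result
   does not depend on it. Hence h pi_0 has a lift H, with H(x+1) = H(x) + e.

   Degree. Lifting singular simplices gives an integer 1-cochain on the circle
   ("winding") that vanishes on boundaries, is 1 on the standard loop, and is
   multiplied by e on cycles pushed forward by h. Surjectivity of h_* on H_1 then
   forces e = 1 or -1, and shifting a lift F of f by an integer gives H F = d H.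

   Expansion. A bounded D with D F = d D vanishes, as |d|^n D stays bounded; for
   two semiconjugacies this applies to H_1 - (e_1 e_2) H_2 + const. If f is a
   covering, F is injective, so F F is nondecreasing; since e H - id is bounded
   and d^2n (e H) = (e H) (F F)^n, the map e H is nondecreasing too. *)
Require Import Defs.
From HB Require Import structures.
From mathcomp Require Import all_boot all_order all_algebra ring lra.
From mathcomp Require Import all_classical all_reals topology normedtype.
From mathcomp Require Import trigo derive realfun complex freeg.
Set Implicit Arguments.
Unset Strict Implicit.
Unset Printing Implicit Defensive.
Import Order.TTheory GRing.Theory Num.Theory numFieldNormedType.Exports.
Local Open Scope classical_set_scope.
Local Open Scope ring_scope.
Local Open Scope quotient_scope.

(** * Angles *)

Section Angles.
Variable R : realType.
Implicit Types x y c s : R.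

Lemma cos2piDnat x n : cos (2 * pi * (x + n%:R)) = cos (2 * pi * x).
Proof.
rewrite -(periodicn (@cosD2pi R) n (2 * pi * x)); congr cos.
by rewrite -mulr_natr -[pi *+ 2]mulr_natr; ring.
Qed.

Lemma sin2piDnat x n : sin (2 * pi * (x + n%:R)) = sin (2 * pi * x).
Proof.
rewrite -(periodicn (@sinD2pi R) n (2 * pi * x)); congr sin.
by rewrite -mulr_natr -[pi *+ 2]mulr_natr; ring.
Qed.

Lemma cos2piDint x (k : int) : cos (2 * pi * (x + k%:~R)) = cos (2 * pi * x).
Proof.
case: k => n; first exact: cos2piDnat.
by rewrite -(cos2piDnat _ n.+1) NegzE mulrNz subrK.
Qed.

Lemma sin2piDint x (k : int) : sin (2 * pi * (x + k%:~R)) = sin (2 * pi * x).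
Proof.
case: k => n; first exact: sin2piDnat.
by rewrite -(sin2piDnat _ n.+1) NegzE mulrNz subrK.
Qed.

(** Modulo integers [x] is some [r] in [0, 1[. There 1 - cos (2 pi r) = 2 sin^2 (pi r), which is
    positive unless r = 0. *)
Lemma cos2pi_eq1 x : cos (2 * pi * x) = 1 -> exists k : int, x = k%:~R.
Proof.
pose r := x - (Num.floor x)%:~R.
have xE : x = r + (Num.floor x)%:~R by rewrite subrK.
rewrite xE cos2piDint => cr.
have /andP[r0 r1] : 0 <= r < 1.
  by rewrite subr_ge0 ltrBlDr addrC ge_floor -intrD1 floorD1_gt.
exists (Num.floor x); move: r0; rewrite le_eqVlt => /orP[/eqP <-|r0].
  by rewrite add0r.
have s0 : 0 < sin (pi * r).
  apply: sin_gt0_pi; rewrite mulr_gt0 ?pi_gt0 //=.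
  by rewrite -[ltRHS]mulr1 ltr_pM2l ?pi_gt0.
move: cr; have -> : 2 * pi * r = (pi * r) *+ 2 by rewrite -mulr_natl; ring.
rewrite cos_mulr2n; have := cos2Dsin2 (pi * r).
by move: s0 => /(exprn_gt0 2); set a := sin _ ^+ 2; set b := cos _ ^+ 2; lra.
Qed.

Lemma cos_sin2pi_inj x y :
  cos (2 * pi * x) = cos (2 * pi * y) -> sin (2 * pi * x) = sin (2 * pi * y) ->
  exists k : int, x = y + k%:~R.
Proof.
move=> cE sE; have [k kE] : exists k : int, x - y = k%:~R.
  apply: cos2pi_eq1; rewrite mulrBr cosB cE sE -!expr2; exact: cos2Dsin2.
by exists k; rewrite -kE addrC subrK.
Qed.

(** A positive cosine keeps the sine away from 1 and -1; the strict bounds serve the continuity of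
    [asin], used on the open interval. *)
Lemma asin_bounds c s : c ^+ 2 + s ^+ 2 = 1 -> 0 < c -> -1 < s < 1.
Proof.
move=> cs c0; rewrite -ltr_norml; apply/real_ltr_normlP; rewrite ?num_real//.
by split; nra.
Qed.

Lemma circle_angle c s : c ^+ 2 + s ^+ 2 = 1 ->
  exists x, c = cos (2 * pi * x) /\ s = sin (2 * pi * x).
Proof.
move=> cs; have c1 : -1 <= c <= 1 by apply/andP; split; nra.
have p0 : 2 * (pi : R) != 0 by rewrite mulf_neq0 ?pnatr_eq0 ?gt_eqF ?pi_gt0.
have sE : Num.sqrt (1 - c ^+ 2) = `|s| by rewrite -sqrtr_sqr; congr Num.sqrt; lra.
have [s0|s0] := leP 0 s.
  exists (acos c / (2 * pi)); rewrite mulrC divfK// acosK// sin_acos// sE.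
  by rewrite ger0_norm.
exists (- (acos c / (2 * pi))); rewrite mulrN mulrC divfK// cosN sinN acosK//.
by rewrite sin_acos// sE ltr0_norm// opprK.
Qed.

(** Rotating (c, s) back by the angle of [a] gives a point whose abscissa is the quantity assumed
    positive. It lies in the right half-plane, so its angle is the arcsine of its ordinate. *)
Lemma circle_angle_step a c s : c ^+ 2 + s ^+ 2 = 1 ->
  0 < cos (2 * pi * a) * c + sin (2 * pi * a) * s ->
  let b := a + asin (cos (2 * pi * a) * s - sin (2 * pi * a) * c) / (2 * pi) in
  c = cos (2 * pi * b) /\ s = sin (2 * pi * b).
Proof.
move=> cs D0 b.
have p0 : 2 * (pi : R) != 0 by rewrite mulf_neq0 ?pnatr_eq0 ?gt_eqF ?pi_gt0.
rewrite /b mulrDr [_ * (asin _ / _)]mulrC divfK// cosD sinD.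
move: (cos2Dsin2 (2 * pi * a)) D0; set c1 := cos _; set s1 := sin _ => c1s1 D0.
have DK : (c1 * c + s1 * s) ^+ 2 + (c1 * s - s1 * c) ^+ 2 = 1.
  by transitivity ((c1 ^+ 2 + s1 ^+ 2) * (c ^+ 2 + s ^+ 2)); [ring|rewrite cs c1s1 mulr1].
have /andP[K1 K2] := asin_bounds DK D0.
have KI : -1 <= c1 * s - s1 * c <= 1 by rewrite !ltW.
rewrite cos_asin// asinK//.
have -> : Num.sqrt (1 - (c1 * s - s1 * c) ^+ 2) = c1 * c + s1 * s.
  rewrite -DK addrK sqrtr_sqr ger0_norm //; exact: ltW.
split.
  by transitivity ((c1 ^+ 2 + s1 ^+ 2) * c); [rewrite c1s1 mul1r|ring].
by transitivity ((c1 ^+ 2 + s1 ^+ 2) * s); [rewrite c1s1 mul1r|ring].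
Qed.

Lemma int_valued_constant (g : R -> R) a b : a <= b ->
  {within `[a, b], continuous g} ->
  (forall x, x \in `[a, b] -> exists k : int, g x = k%:~R) -> g a = g b.
Proof.
move=> ab gc gi; have [k kE] : exists k : int, g a = k%:~R.
  by apply: gi; rewrite in_itv/= lexx.
have [l lE] : exists k : int, g b = k%:~R by apply: gi; rewrite in_itv/= lexx ab.
case: (eqVneq (g a) (g b)) => // nab.
pose m : int := Num.min k l.
have mE : Num.min (g a) (g b) = m%:~R.
  by rewrite /m kE lE !minElt ltr_int; case: (k < l).
(* If the end values differed, [g] would take the value m + 1/2, with m the smaller of the two
   integers. *)
have [|c cab] := @IVT R g a b (m%:~R + 2^-1) ab gc.
  rewrite mE lerDl invr_ge0 ler0n /=.
  have kl : k != l by apply: contra_neq nab => kl; rewrite kE lE kl.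
  apply: (@le_trans _ _ ((m + 1)%:~R)); first by rewrite intrD; lra.
  rewrite kE lE maxElt ltr_int /m minElt; move: kl.
  by case: ltgtP => // kl _; rewrite ler_int lezD1.
have [j ->] := gi _ cab.
move=> jE; have : (m < j < m + 1) by rewrite -!(ltr_int R) jE intrD; lra.
by case/andP; rewrite ltzD1; case: ltgtP.
Qed.

End Angles.

(** * Lifting circle-valued maps *)

Section Lifting.
Variables (R : realType) (V : normedModType R) (c s : V -> R).
Hypothesis cs1 : forall v, c v ^+ 2 + s v ^+ 2 = 1.
Hypotheses (c_cont : continuous c) (s_cont : continuous s).

(** [dot] and [crs] are the cosine and the sine of the angle from the value at [x] to the value at
    [y]. *)
Let dot x y := c x * c y + s x * s y.
Let crs x y := c x * s y - s x * c y.

(** On the ray through [v], parameters at most 1/N apart give values less than a quarter turn apart.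
    Arbitrary starting points [t], not just multiples of 1/N, let the property pass to shorter
    segments. *)
Let small_steps (N : nat) (v : V) := forall t e : R,
  0 <= t <= 1 -> 0 <= e -> e * N%:R <= 1 -> 0 < dot (t *: v) ((t + e) *: v).

Let turn (N m : nat) (v : V) : R :=
  \sum_(k < m) asin (crs ((k%:R / N%:R) *: v) ((k.+1%:R / N%:R) *: v)) / (2 * pi).


Let small_stepsZ N v (t : R) : 0 <= t <= 1 -> small_steps N v -> small_steps N (t *: v).
Proof.
move=> /andP[t0 t1] gN u e /andP[u0 u1] e0 eN.
rewrite !scalerA mulrDl; apply: gN.
- by rewrite mulr_ge0//= mulr_ile1.
- exact: mulr_ge0.
by rewrite mulrAC mulr_ile1// mulr_ge0.
Qed.

(** At step e = 0 the dot product is 1, so it stays positive near (0, v) for each [t]. Compactness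
    of [0, 1] makes the neighbourhood uniform in [t], and 1/N is taken below its radius in [e]. *)
Let small_steps_near (v : V) : exists N, (0 < N)%N /\ \forall w \near v, small_steps N w.
Proof.
have : compact (`[0, 1]%classic : set R) by exact: segment_compact.
move=> /compact_near_coveringP nc.
have [|[A B] /= [A0 Bv] AB] := nc (R * V)%type (nbhs (0 : R, v))
  (fun p t => 0 < dot (t *: p.2) ((t + p.1) *: p.2)) _.
  move=> t _.
  pose g (q : R * (R * V)) := dot (q.1 *: q.2.2) ((q.1 + q.2.1) *: q.2.2).
  have gc : {for (t, (0, v)), continuous g}.
    have c1 (f : V -> R) : continuous f -> {for (t, (0, v)), continuous
        (fun q : R * (R * V) => f (q.1 *: q.2.2))}.
      move=> fc; apply: (@continuous_comp _ _ _
        (fun q : R * (R * V) => q.1 *: q.2.2)); last exact: fc.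
      by apply: cvgZ; [exact: cvg_fst|apply: cvg_comp; [exact: cvg_snd|exact: cvg_snd]].
    have c2 (f : V -> R) : continuous f -> {for (t, (0, v)), continuous
        (fun q : R * (R * V) => f ((q.1 + q.2.1) *: q.2.2))}.
      move=> fc; apply: (@continuous_comp _ _ _
        (fun q : R * (R * V) => (q.1 + q.2.1) *: q.2.2)); last exact: fc.
      apply: cvgZ; last by apply: cvg_comp; [exact: cvg_snd|exact: cvg_snd].
      apply: cvgD; first exact: cvg_fst.
      by apply: cvg_comp; [exact: cvg_snd|exact: cvg_fst].
    by apply: cvgD; apply: cvgM; by [exact: c1|exact: c2].
  have g0 : 0 < g (t, (0, v)).
    by rewrite /g /dot /= addr0 -!expr2 cs1.
  exact: (cvgr_gt _ gc).
move: A0 => /nbhs_ballP[r /= r0 rA].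
have [N Nr] : exists N, (0 < N)%N /\ N%:R^-1 < r.
  exists (Num.truncn r^-1).+1; split => //.
  rewrite invf_plt ?posrE//; exact: truncnS_gt.
exists N; case: Nr => N0 Nr; split => //; apply: filterS Bv => w Bw t e t01 e0 eN.
apply: (AB (e, w)) => /=; last by rewrite in_itv.
split => //=; apply: rA; rewrite /ball/= sub0r normrN ger0_norm//.
by apply: le_lt_trans Nr; rewrite -[leRHS]mul1r ler_pdivlMr ?ltr0n.
Qed.

Let step_frac (N k : nat) :
  k.+1%:R / N%:R = k%:R / N%:R + N%:R^-1 :> R.
Proof. by rewrite -natr1 mulrDl mul1r. Qed.

Let step_bounds (N k : nat) : (k < N)%N -> 0 <= (k%:R / N%:R : R) <= 1.
Proof.
move=> kN; have N0 : 0 < N%:R :> R by rewrite ltr0n (leq_trans _ kN).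
by rewrite divr_ge0//= ler_pdivrMr// mul1r ler_nat ltnW.
Qed.

Let dot_step (N k : nat) v : (k < N)%N -> small_steps N v ->
  0 < dot ((k%:R / N%:R) *: v) ((k.+1%:R / N%:R) *: v).
Proof.
move=> kN gN; have N0 : (0 < N)%N by rewrite (leq_trans _ kN).
rewrite step_frac; apply: gN; first exact: step_bounds.
  by rewrite invr_ge0.
by rewrite mulVf// pnatr_eq0 -lt0n.
Qed.

Let dot_crs x y : dot x y ^+ 2 + crs x y ^+ 2 = 1.
Proof.
transitivity ((c x ^+ 2 + s x ^+ 2) * (c y ^+ 2 + s y ^+ 2)).
  by rewrite /dot /crs; ring.
by rewrite !cs1 mulr1.
Qed.

Let turn_lift a N m v : c 0 = cos (2 * pi * a) -> s 0 = sin (2 * pi * a) ->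
  (m <= N)%N -> small_steps N v ->
  c ((m%:R / N%:R) *: v) = cos (2 * pi * (a + turn N m v)) /\
  s ((m%:R / N%:R) *: v) = sin (2 * pi * (a + turn N m v)).
Proof.
move=> ca sa + gN; elim: m => [|m IH] mN.
  by rewrite /turn big_ord0 mul0r scale0r addr0.
have [cm sm] := IH (ltnW mN).
rewrite /turn big_ord_recr /= -/(turn N m v) /crs cm sm addrA.
apply: circle_angle_step; first exact: cs1.
by rewrite -cm -sm; exact: dot_step.
Qed.

Let turn_cont N m v : (m <= N)%N -> small_steps N v ->
  {for v, continuous (turn N m)}.
Proof.
move=> mN gN.
have zc (f : V -> R) (r : R) : continuous f -> continuous (fun w => f (r *: w)).
  move=> fc w; apply: (@continuous_comp _ _ _ (fun w => r *: w)).
    exact: scaler_continuous.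
  exact: fc.
apply: cvg_big => [|k _]; first exact: add_continuous.
apply: cvgM; last exact: cvg_cst.
apply: (@continuous_comp _ _ _
   (fun w => crs ((k%:R / N%:R) *: w) ((k.+1%:R / N%:R) *: w)) (@asin R)).
  by apply: cvgB; apply: cvgM; exact: zc.
apply: continuous_asin; apply: asin_bounds (dot_crs _ _) _.
by apply: dot_step => //; exact: leq_trans mN.
Qed.

(** Along [t *: v] both sums complete the same starting angle to an angle of the same point. Their
    difference is continuous and integer-valued in [t], and it vanishes at t = 0. *)
Let turn_indep N M v : (0 < N)%N -> (0 < M)%N ->
  small_steps N v -> small_steps M v -> turn N N v = turn M M v.
Proof.
move=> N0 M0 gN gM; have [a [ca sa]] := circle_angle (cs1 0).
pose g t := turn N N (t *: v) - turn M M (t *: v).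
have zero K : turn K K (0 *: v) = 0.
  rewrite /turn big1// => k _; rewrite !scale0r !scaler0 /crs [c 0 * s 0]mulrC subrr.
  by rewrite -[X in asin X](@sin0 R) sinK ?mul0r// in_itv/= oppr_le0 divr_ge0 ?pi_ge0.
suff : g 0 = g 1.
  by rewrite /g !zero subrr !scale1r => /esym/eqP; rewrite subr_eq0 => /eqP.
apply: int_valued_constant => //.
  apply: continuous_in_subspaceT => t; rewrite inE/= in_itv/= => t01.
  have vc (K : nat) : small_steps K v ->
      {for t, continuous (fun t : R => turn K K (t *: v))}.
    move=> gK; apply: (@continuous_comp _ _ _ (fun t : R => t *: v)).
      exact: scalel_continuous.
    by apply: turn_cont => //; exact: small_stepsZ.
  by apply: cvgB; exact: vc.
move=> t; rewrite in_itv/= => t01.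
have [cN sN] := turn_lift ca sa (leqnn N) (small_stepsZ t01 gN).
have [cM sM] := turn_lift ca sa (leqnn M) (small_stepsZ t01 gM).
rewrite divff ?pnatr_eq0 -?lt0n// in cN sN.
rewrite divff ?pnatr_eq0 -?lt0n// in cM sM.
rewrite cN in cM; rewrite sN in sM.
have [k kE] := cos_sin2pi_inj cM sM.
by exists k; rewrite /g; apply: (@addrI _ a); rewrite addrA kE; ring.
Qed.

Lemma cos_sin_lifting : exists2 H : V -> R, continuous H &
  forall v, c v = cos (2 * pi * H v) /\ s v = sin (2 * pi * H v).
Proof.
have [a [ca sa]] := circle_angle (cs1 0).
have [N N_] := choice small_steps_near.
have gN v : small_steps (N v) v by have [_ /nbhs_singleton] := N_ v.
exists (fun v => a + turn (N v) (N v) v) => v; last first.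
  have [N0 _] := N_ v; have := turn_lift ca sa (leqnn (N v)) (gN v).
  by rewrite divff ?pnatr_eq0 -?lt0n// scale1r.
(* The number of steps varies with the point. Continuity is shown with [N v] frozen, which near [v]
   gives the same sum. *)
have : (fun w => a + turn (N v) (N v) w) @ v --> a + turn (N v) (N v) v.
  by apply: cvgD; [exact: cvg_cst|apply: turn_cont].
apply: cvg_trans; apply: near_eq_cvg.
have [N0 near_v] := N_ v; apply: filterS near_v => w gw.
by congr (a + _); apply: turn_indep => //; have [] := N_ w.
Qed.

End Lifting.

(** * Coordinates and topology of the circle, its covering by the line, and lifts *)

Section CircleMaps.
Variable R : realType.
Implicit Types (z w : circle R) (x y : R).

Definition circle_re z : R := complex.Re (val z).
Definition circle_im z : R := complex.Im (val z).

Lemma circle_re_im z : circle_re z ^+ 2 + circle_im z ^+ 2 = 1.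
Proof.
have : `|val z| = 1 by exact: set_mem (valP z).
rewrite normc_def => -[] e.
have e0 : 0 <= circle_re z ^+ 2 + circle_im z ^+ 2 by rewrite addr_ge0 ?sqr_ge0.
by rewrite -(sqr_sqrtr e0) [Num.sqrt _]e expr1n.
Qed.

Lemma circle_eq z w : circle_re z = circle_re w -> circle_im z = circle_im w -> z = w.
Proof.
rewrite /circle_re /circle_im => re im; apply: val_inj.
by move: re im; case: (val z) (val w) => [a b] [a' b'] /= -> ->.
Qed.

Lemma circle_val_continuous : continuous (val : circle R -> R[i]).
Proof. exact: (@initial_continuous _ _ (val : set_type (@unit_circle R) -> _)). Qed.

Lemma complex_Re_continuous : continuous (@complex.Re R : R[i] -> R).
Proof.
move=> z; have FF : Filter (nbhs (z : R[i])) := nbhs_filter z.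
apply/(@cvgrPdist_lt _ _ _ _ FF) => e e0.
apply/nbhs_ballP; exists (e%:C)%C; first by rewrite /= ltcR.
move=> {FF} w; rewrite -ball_normE /= -ltcR; apply: le_lt_trans.
by have := normc_ge_Re (z - w); case: z w => [a b] [a' b'].
Qed.

Lemma complex_Im_continuous : continuous (@complex.Im R : R[i] -> R).
Proof.
move=> z; have FF : Filter (nbhs (z : R[i])) := nbhs_filter z.
apply/(@cvgrPdist_lt _ _ _ _ FF) => e e0.
apply/nbhs_ballP; exists (e%:C)%C; first by rewrite /= ltcR.
move=> {FF} w; rewrite -ball_normE /= -ltcR; apply: le_lt_trans.
case: z w => [a b] [a' b'] /=; rewrite normc_def /= lecR -sqrtr_sqr.
by apply: ler_wsqrtr; rewrite lerDr sqr_ge0.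
Qed.

Lemma circle_re_continuous : continuous circle_re.
Proof.
move=> z; apply: continuous_comp; first exact: circle_val_continuous.
exact: complex_Re_continuous.
Qed.

Lemma circle_im_continuous : continuous circle_im.
Proof.
move=> z; apply: continuous_comp; first exact: circle_val_continuous.
exact: complex_Im_continuous.
Qed.

Lemma complex_dist_lt (u v : R[i]) (e : R) :
  `|complex.Re u - complex.Re v| < e / 2 ->
  `|complex.Im u - complex.Im v| < e / 2 -> `|u - v| < (e%:C)%C.
Proof.
case: u v => [a b] [a' b'] /= aa bb; rewrite normc_def /= ltcR.
have : Num.sqrt ((a - a') ^+ 2 + (b - b') ^+ 2) <= `|a - a'| + `|b - b'|.
  rewrite -[leRHS]ger0_norm ?addr_ge0// -sqrtr_sqr ler_wsqrtr//.
  rewrite [(`|_| + _) ^+ 2]sqrrD !real_normK ?num_real//.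
  by rewrite lerD2r lerDl mulrn_wge0// mulr_ge0.
by lra.
Qed.

Lemma circle_valued_continuous (X : topologicalType) (g : X -> circle R) :
  continuous (circle_re \o g) -> continuous (circle_im \o g) -> continuous g.
Proof.
move=> re im; apply: continuous_comp_initial => x.
(* The radius is a positive complex number, hence has zero imaginary part. *)
apply/cvgrPdist_lt => -[e e']; rewrite ltcE/= => /andP[/eqP-> e1].
have e2 : 0 < e / 2 by rewrite divr_gt0.
have /cvgrPdist_lt/(_ _ e2) := re x; have /cvgrPdist_lt/(_ _ e2) := im x.
by apply: filterS2 => y bb aa; exact: complex_dist_lt.
Qed.

Lemma pi0_continuous : continuous (@pi0 R).
Proof.
have lin : continuous (fun x : R => 2 * pi * x).
  by move=> x; apply: cvgM; [exact: cvg_cst|exact: cvg_id].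
apply: circle_valued_continuous => x.
- by apply: (@continuous_comp _ _ _ _ (@cos R)); [exact: lin|exact: continuous_cos].
- by apply: (@continuous_comp _ _ _ _ (@sin R)); [exact: lin|exact: continuous_sin].
Qed.

Lemma pi0Dint x (k : int) : pi0 (x + k%:~R) = pi0 x.
Proof. by apply: circle_eq; [exact: cos2piDint|exact: sin2piDint]. Qed.

Lemma pi0_eq x y : pi0 x = pi0 y -> exists k : int, x = y + k%:~R.
Proof.
move=> xy; apply: cos_sin2pi_inj; first exact: (congr1 circle_re xy).
exact: (congr1 circle_im xy).
Qed.

Lemma pi0_surj z : exists x, pi0 x = z.
Proof.
have [x [xc xs]] := circle_angle (circle_re_im z).
by exists x; apply: circle_eq.
Qed.

Lemma pi0_lifting (V : normedModType R) (K : V -> circle R) : continuous K ->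
  exists2 H : V -> R, continuous H & forall v, pi0 (H v) = K v.
Proof.
move=> Kc; have [|v|v|H Hc HK] := @cos_sin_lifting R V (circle_re \o K) (circle_im \o K).
- by move=> v; exact: circle_re_im.
- by apply: continuous_comp; [exact: Kc|exact: circle_re_continuous].
- by apply: continuous_comp; [exact: Kc|exact: circle_im_continuous].
exists H => // v; have [cv sv] := HK v; exact: circle_eq.
Qed.

Lemma val_pi0D x y : val (pi0 (x + y)) = val (pi0 x) * val (pi0 y).
Proof.
rewrite /= mulrDr cosD sinD; set a := 2 * pi * x; set b := 2 * pi * y.
transitivity (Complex (cos a * cos b - sin a * sin b) (cos a * sin b + sin a * cos b)) => //.
by congr Complex; rewrite addrC.
Qed.

Lemma val_pi00 : val (pi0 (0 : R)) = 1.
Proof. by rewrite /= mulr0 cos0 sin0. Qed.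

Lemma power_map_pi0 (d : int) x : power_map d (pi0 x) = pi0 (d%:~R * x).
Proof.
apply: val_inj; rewrite [LHS]/=.
have nat_pow n : val (pi0 x) ^+ n = val (pi0 (n%:R * x)).
  elim: n => [|n IH]; first by rewrite mul0r val_pi00.
  by rewrite exprS IH -val_pi0D -natr1 mulrDl mul1r addrC.
case: d => n; first exact: nat_pow.
rewrite NegzE /= -exprnN nat_pow mulrNz mulNr; set y := _ * x.
have yN : val (pi0 y) * val (pi0 (- y)) = 1 by rewrite -val_pi0D subrr val_pi00.
have y0 : val (pi0 y) != 0.
  by apply/eqP => e; move/eqP: yN; rewrite e mul0r eq_sym oner_eq0.
by apply: (mulfI y0); rewrite yN divff.
Qed.

(** The difference of the two maps is continuous with integer values, hence constant. *)
Lemma lift_difference (H1 H2 : R -> R) : continuous H1 -> continuous H2 ->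
  (forall x, pi0 (H1 x) = pi0 (H2 x)) -> exists k : int, forall x, H1 x = H2 x + k%:~R.
Proof.
move=> c1 c2 e; have [k kE] := pi0_eq (e 0); exists k => x.
pose g := H1 \- H2.
have const a b : a <= b -> g a = g b.
  move=> ab; apply: int_valued_constant ab _ _.
    by apply: continuous_subspaceT => y; apply: cvgB; [exact: c1|exact: c2].
  by move=> y _; have [l lE] := pi0_eq (e y); exists l; rewrite /g /= lE addrC addKr.
have : g x = g 0 by have [/const|/ltW/const] := leP x 0.
by rewrite /g /= kE => ?; lra.
Qed.

End CircleMaps.

(** * Winding numbers *)

Section Winding.
Variable R : realType.
Implicit Types (p : R -> circle R) (z : circle R).

(** An arbitrarily chosen preimage under [pi0], with no continuity in [z] claimed. *)
Definition angle z : R := sval (cid (pi0_surj z)).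

Lemma angleK z : pi0 (angle z) = z.
Proof. by rewrite /angle; case: cid. Qed.

Lemma lift_angle x z : pi0 x = z -> exists k : int, x = angle z + k%:~R.
Proof. by move=> xz; apply: pi0_eq; rewrite angleK. Qed.

(* The number of turns of a path over [0, pi/2], completed to an integer by the
   reference angles of its endpoints. *)
Definition winding p : int :=
  let L := xget (fun=> 0) [set L : R -> R | continuous L /\ forall t, pi0 (L t) = p t] in
  Num.floor ((L (pi / 2) - angle (p (pi / 2))) - (L 0 - angle (p 0))).

(** Another lift differs by a constant, which cancels. Each of the two brackets is an integer, so
    the floor is exact. *)
Lemma windingE p (L : R -> R) : continuous L -> (forall t, pi0 (L t) = p t) ->
  (winding p)%:~R = (L (pi / 2) - angle (p (pi / 2))) - (L 0 - angle (p 0)).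
Proof.
move=> Lc Lp; rewrite /winding; case: xgetP => [M _ [Mc Mp]|/(_ L)/(_ (conj Lc Lp))//].
have [k kE] := lift_difference Lc Mc (fun x => etrans (Lp x) (esym (Mp x))).
rewrite !kE; have [i ->] := lift_angle (Mp (pi / 2)); have [j ->] := lift_angle (Mp 0).
rewrite (addrC (angle (p (pi / 2)))) addrK (addrC (angle (p 0))) addrK -intrB intrKfloor.
by rewrite intrB; ring.
Qed.

(** The increments of a planar lift along three sides of a square add up to the increment along the
    fourth, and the reference angles cancel. The fourth side is sent to a point, so the lift is
    constant on it. *)
Lemma winding_triangle (K : R * R -> circle R) : continuous K ->
  (forall v, K (0, v) = K (0, 0)) ->
  winding (fun t => K (pi / 2, t)) - winding (fun t => K (t, pi / 2)) +
  winding (fun t => K (t, 0)) = 0.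
Proof.
move=> Kc K0; have [H Hc HK] := @pi0_lifting R (R^o * R^o)%type K Kc.
have slice1 (a : R) : continuous (fun t : R => H (a, t)).
  move=> t; apply: (@continuous_comp _ _ _ (fun t : R => (a, t))); last exact: Hc.
  exact: (cvg_pair (cvg_cst _) cvg_id).
have slice2 (a : R) : continuous (fun t : R => H (t, a)).
  move=> t; apply: (@continuous_comp _ _ _ (fun t : R => (t, a))); last exact: Hc.
  exact: (cvg_pair cvg_id (cvg_cst _)).
apply: (@intr_inj R); rewrite intrD intrB.
rewrite (windingE (slice1 (pi / 2))) // (windingE (slice2 (pi / 2))) //.
rewrite (windingE (slice2 0)) // !K0.
have [k kE] := lift_difference (slice1 0) (fun x => cvg_cst (H (0, 0)))
  (fun v => etrans (HK (0, v)) (etrans (K0 v) (esym (HK (0, 0))))).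
have := kE 0; have := kE (pi / 2); rewrite /cst => -> e.
have -> : k%:~R = 0 :> R by apply: (@addrI _ (H (0, 0))); rewrite -e addr0.
by ring.
Qed.

Lemma winding_pi0 (L : R -> R) (k : int) : continuous L ->
  L (pi / 2) = L 0 + k%:~R -> winding (fun t => pi0 (L t)) = k.
Proof.
move=> Lc e; apply: (@intr_inj R); rewrite (windingE Lc) // e pi0Dint; ring.
Qed.

Lemma degree_int (H : R -> R) (e : int) : (forall x, H (x + 1) = H x + e%:~R) ->
  forall x (k : int), H (x + k%:~R) = H x + (e * k)%:~R.
Proof.
move=> H1.
have Hn x (n : nat) : H (x + n%:R) = H x + (e * n)%:~R.
  elim: n => [|n IH]; first by rewrite mulr0 !addr0.
  by rewrite -natr1 addrA H1 IH -addrA -intrD -[in RHS]addn1 PoszD mulrDr mulr1.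
move=> x [] n; first exact: Hn.
rewrite NegzE; have := Hn (x - n.+1%:R) n.+1; rewrite subrK => ->.
by rewrite mulrN !mulrNz addrK.
Qed.

(** The difference under the floor is an integer when [H] lifts [h]. It is a 0-cochain recording how
    [H] fails to respect the reference angles. *)
Definition lift_defect (H : R -> R) (h : circle R -> circle R) z : int :=
  Num.floor (H (angle z) - angle (h z)).

(** If [L] lifts [p], then [H \o L] lifts [h \o p], and [H] multiplies integer shifts by [e].
    Changing reference angles at the two endpoints contributes the coboundary of [lift_defect]. *)
Lemma winding_comp (H : R -> R) (h : circle R -> circle R) (e : int) p :
  continuous p -> is_lift H h -> (forall x, H (x + 1) = H x + e%:~R) ->
  winding (h \o p) =
  e * winding p + (lift_defect H h (p (pi / 2)) - lift_defect H h (p 0)).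
Proof.
move=> pc [Hc Hh] H1; have [L Lc Lp] := @pi0_lifting R R^o p pc.
have HLc : continuous (H \o L) by move=> t; apply: continuous_comp; [exact: Lc|exact: Hc].
apply: (@intr_inj R); rewrite (windingE HLc) /=; last by move=> t; rewrite Hh Lp.
rewrite intrD intrM intrB (windingE Lc Lp) /lift_defect.
have defect z : (Num.floor (H (angle z) - angle (h z)))%:~R = H (angle z) - angle (h z).
  have [k ->] : exists k : int, H (angle z) = angle (h z) + k%:~R.
    by apply: lift_angle; rewrite Hh angleK.
  by rewrite addrC addKr intrKfloor.
rewrite !defect; have [i ->] := lift_angle (Lp (pi / 2)); have [j ->] := lift_angle (Lp 0).
by rewrite !(degree_int H1) !intrM; ring.
Qed.

End Winding.

(** * Parametrized simplices *)

Section FreeGroupLift.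
Variable K : choiceType.
Implicit Types (f g : K -> int^o) (c : {freeg K}).

HB.instance Definition _ f :=
  GRing.isZmodMorphism.Build {freeg K} int^o (fglift f) (lift_is_additive f).

Lemma fglift0 c : fglift (fun=> 0 : int^o) c = 0.
Proof.
rewrite -[c]Freeg_enum fglift_Freeg /prelift big1// => x _; exact: scaler0.
Qed.

Lemma fgliftD f g c : fglift (fun x => f x + g x) c = fglift f c + fglift g c.
Proof.
rewrite -[c]Freeg_enum !fglift_Freeg /prelift -big_split.
by apply: eq_bigr => x _; exact: scalerDr.
Qed.

Lemma fgliftM (e : int) f c : fglift (fun x => e * f x : int^o) c = e * fglift f c.
Proof.
rewrite -[c]Freeg_enum !fglift_Freeg /prelift mulr_sumr.
by apply: eq_bigr => x _; exact: mulrCA.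
Qed.

Lemma fgliftU f (x : K) : fglift f << x >> = f x.
Proof. by rewrite liftU scale1r. Qed.

End FreeGroupLift.

(** * Edges and triangles parametrized by the line and the plane *)

Section Simplices.
Variable R : realType.

Lemma row_valued_continuous (X : topologicalType) n (g : X -> 'rV[R]_n) :
  (forall j, continuous (fun x => g x 0 j)) -> continuous g.
Proof.
move=> gc x A [P gP PA]; have : \forall y \near x, forall j, P 0 j (g y 0 j).
  by apply: filter_forall => j; apply: gc; exact: gP.
apply: filterS => y Py; apply: PA => i j; rewrite (ord1 i); exact: Py.
Qed.

Lemma sqr_cos_continuous : continuous (fun t : R => cos t ^+ 2).
Proof. by move=> t; apply: cvgM; exact: continuous_cos. Qed.

Lemma sqr_sin_continuous : continuous (fun t : R => sin t ^+ 2).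
Proof. by move=> t; apply: cvgM; exact: continuous_sin. Qed.

Definition edge_row (t : R) : 'rV[R]_2 := \row_j [:: cos t ^+ 2; sin t ^+ 2]`_j.

Lemma edge_simplex t : simplex_set (edge_row t).
Proof.
split=> [i|]; first by rewrite mxE; case: i => -[|[|]] //= _; exact: sqr_ge0.
by rewrite !big_ord_recl big_ord0 !mxE /= addr0 cos2Dsin2.
Qed.

(* The edge from (1, 0) to (0, 1) as t runs over [0, pi/2]: squares of cosines
   and sines define it on all of R without clamping. *)
Definition edge (t : R) : simplex R 1 := exist _ (edge_row t) (mem_set (edge_simplex t)).

Lemma edge_continuous : continuous edge.
Proof.
apply: continuous_comp_initial; apply: row_valued_continuous => j.
under [X in continuous X]eq_fun do rewrite mxE.
case: j => -[|[|]] //= _; [exact: sqr_cos_continuous|exact: sqr_sin_continuous].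
Qed.

(** Squares of spherical coordinates. On the square [0, pi/2]^2 the side [p.1 = 0] collapses to a
    vertex and the other three sides trace the faces. *)
Definition triangle_row (p : R * R) : 'rV[R]_3 :=
  \row_j [:: cos p.1 ^+ 2; sin p.1 ^+ 2 * cos p.2 ^+ 2; sin p.1 ^+ 2 * sin p.2 ^+ 2]`_j.

Lemma triangle_simplex p : simplex_set (triangle_row p).
Proof.
split=> [i|].
  rewrite mxE; case: i => -[|[|[|]]] //= _; first exact: sqr_ge0.
    by apply: mulr_ge0; exact: sqr_ge0.
  by apply: mulr_ge0; exact: sqr_ge0.
by rewrite !big_ord_recl big_ord0 !mxE /= addr0 -mulrDr cos2Dsin2 mulr1 cos2Dsin2.
Qed.

Definition triangle (p : R * R) : simplex R 2 :=
  exist _ (triangle_row p) (mem_set (triangle_simplex p)).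

Lemma triangle_continuous : continuous triangle.
Proof.
apply: continuous_comp_initial; apply: row_valued_continuous => j.
under [X in continuous X]eq_fun do rewrite mxE.
have c1 (f : R -> R) : continuous f -> continuous (fun p : R * R => f p.1).
  by move=> fc p; apply: continuous_comp; [exact: cvg_fst|exact: fc].
have c2 (f : R -> R) : continuous f -> continuous (fun p : R * R => f p.2).
  by move=> fc p; apply: continuous_comp; [exact: cvg_snd|exact: fc].
case: j => -[|[|[|]]] //= _ p.
- exact: c1 sqr_cos_continuous _.
- by apply: cvgM; [exact: c1 sqr_sin_continuous _|exact: c2 sqr_cos_continuous _].
- by apply: cvgM; [exact: c1 sqr_sin_continuous _|exact: c2 sqr_sin_continuous _].
Qed.

Lemma simplex_eq n (s t : simplex R n) : (forall j, val s 0 j = val t 0 j) -> s = t.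
Proof. by move=> st; apply: val_inj; apply/rowP. Qed.

(** The index is constrained through its value so that it may be any term for this ordinal, such as
    the nested [lift] left by expanding a sum. *)
Lemma triangle_face0 (i : 'I_3) t : val i = 0%N -> face i (edge t) = triangle (pi / 2, t).
Proof.
move=> i0; apply: simplex_eq => j; rewrite !mxE; case: unliftP => [k|] -> /=.
  rewrite mxE i0 sin_pihalf expr1n !mul1r; by case: k => -[|[|]].
by rewrite i0 /= cos_pihalf expr0n.
Qed.

Lemma triangle_face1 (i : 'I_3) t : val i = 1%N -> face i (edge t) = triangle (t, pi / 2).
Proof.
move=> i0; apply: simplex_eq => j; rewrite !mxE; case: unliftP => [k|] -> /=.
  rewrite mxE i0 sin_pihalf expr1n !mulr1; by case: k => -[|[|]].
by rewrite i0 /= cos_pihalf expr0n mulr0.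
Qed.

Lemma triangle_face2 (i : 'I_3) t : val i = 2%N -> face i (edge t) = triangle (t, 0).
Proof.
move=> i0; apply: simplex_eq => j; rewrite !mxE; case: unliftP => [k|] -> /=.
  rewrite mxE i0 cos0 expr1n !mulr1; by case: k => -[|[|]].
by rewrite i0 /= sin0 expr0n mulr0.
Qed.

Lemma triangle_vertex v : triangle (0, v) = triangle (0, 0).
Proof.
apply: simplex_eq => j; rewrite !mxE /= sin0 expr0n !mul0r.
by case: j => -[|[|[|]]].
Qed.

Definition vertex : simplex R 0.
Proof.
exists (const_mx 1); apply: mem_set; split=> [i|]; first by rewrite mxE.
by rewrite big_ord1 mxE.
Defined.

Lemma vertex_eq (v : simplex R 0) : v = vertex.
Proof.
apply: simplex_eq => j; rewrite (ord1 j) mxE.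
have [_] : simplex_set (val v) by exact: set_mem (valP v).
by rewrite big_ord1.
Qed.

Lemma edge_face0 (i : 'I_2) : val i = 0%N -> face i vertex = edge (pi / 2).
Proof.
move=> i0; apply: simplex_eq => j; rewrite !mxE; case: unliftP => [k|] -> /=.
  by rewrite mxE i0 sin_pihalf expr1n; case: k => -[|].
by rewrite i0 /= cos_pihalf expr0n.
Qed.

Lemma edge_face1 (i : 'I_2) : val i = 1%N -> face i vertex = edge 0.
Proof.
move=> i0; apply: simplex_eq => j; rewrite !mxE; case: unliftP => [k|] -> /=.
  by rewrite mxE i0 cos0 expr1n; case: k => -[|].
by rewrite i0 /= sin0 expr0n.
Qed.

End Simplices.

(** * The degree of a map bijective on H_1 *)

Section Degree.
Variable R : realType.
Local Notation S1 := (circle R).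

Definition wind : chain R S1 1 -> int^o :=
  fglift (fun s : continuousType (simplex R 1) S1 => winding (s \o @edge R) : int^o).

Lemma boundary_simplex1 (X : topologicalType) (s : continuousType (simplex R 1) X) :
  boundary (<< s >> : chain R X 1) =
  << (s \o face 0 : continuousType _ _) >> - << (s \o face 1 : continuousType _ _) >>.
Proof.
rewrite /boundary liftU scale1r !big_ord_recl big_ord0 expr0 scale1r addr0.
rewrite expr1 scaleN1r; congr (_ - << _ >>).
by apply/continuousEP => v /=; congr (s (face _ _)); apply: val_inj.
Qed.

(** For a single singular triangle [s] this is [winding_triangle] applied to [s \o triangle], whose
    three sides are the faces with alternating signs. *)
Lemma wind_boundary (b : chain R S1 2) : wind (boundary b) = 0.
Proof.
rewrite /wind [boundary b]/boundary raddf_fglift -[RHS](fglift0 b); congr fglift.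
apply/funext => s; rewrite /= !big_ord_recl big_ord0 !raddfD /= raddf0 addr0.
rewrite expr0 expr1 scale1r scaleN1r raddfN /= !fgliftU.
(* The exponent is the index 2 of the last face. *)
have -> : (-1) ^+ bump 0 (bump 0 0) = 1 :> int by [].
rewrite scale1r fgliftU addrA -[RHS](@winding_triangle R (s \o @triangle R)).
- have pathE (i : 'I_3) p : (forall t, face i (edge t) = triangle (p t)) ->
      (s \o face i) \o @edge R = fun t => (s \o @triangle R) (p t).
    by move=> e; apply/funext => t /=; rewrite e.
  pose i1 : 'I_3 := fintype.lift ord0 ord0.
  pose i2 : 'I_3 := fintype.lift ord0 (fintype.lift ord0 ord0).
  rewrite (pathE ord0 _ (fun t => @triangle_face0 R ord0 t erefl)).
  rewrite (pathE i1 _ (fun t => @triangle_face1 R i1 t erefl)).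
  by rewrite (pathE i2 _ (fun t => @triangle_face2 R i2 t erefl)).
- by move=> p; apply: continuous_comp; [exact: triangle_continuous|exact: cts_fun].
- by move=> v; rewrite /= triangle_vertex.
Qed.

(** Simplex by simplex this is [winding_comp]. The correction terms add up to [defect] evaluated on
    the boundary of [c], which is zero for a cycle. *)
Lemma wind_push (h : continuousType S1 S1) (H : R -> R) (e : int) (c : chain R S1 1) :
  is_lift H h -> (forall x, H (x + 1) = H x + e%:~R) ->
  boundary c = 0 -> wind (push h c) = e * wind c.
Proof.
move=> Hh H1 c0.
pose defect (s : continuousType (simplex R 0) S1) : int^o :=
  lift_defect H h (s (vertex R)).
have : fglift defect (boundary c) = 0 by rewrite c0 raddf0.
rewrite [boundary c]/boundary raddf_fglift => d0.
rewrite /wind [push h c]/push raddf_fglift -[RHS]addr0 -d0 -fgliftM -fgliftD.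
congr fglift; apply/funext => s /=.
rewrite fgliftU.
transitivity (e * winding (s \o @edge R) +
    fglift defect (boundary (<< s >> : chain R S1 1))); last first.
  by rewrite [boundary _]liftU scale1r.
rewrite boundary_simplex1 raddfB /= !fgliftU /defect /=.
rewrite (@edge_face0 R 0 erefl) (@edge_face1 R 1 erefl).
rewrite -(@winding_comp R H h e (s \o @edge R)) //.
by move=> t; apply: continuous_comp; [exact: edge_continuous|exact: cts_fun].
Qed.

Definition loop_fun (t : simplex R 1) : S1 := pi0 (val t 0 1).

Lemma loop_continuous : continuous loop_fun.
Proof.
move=> t; apply: (@continuous_comp _ _ _ (fun t : simplex R 1 => val t 0 1));
  last exact: pi0_continuous.
apply: (@continuous_comp _ _ _ (val : simplex R 1 -> 'rV[R]_2) (fun v : 'rV[R]_2 => v 0 1)).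
  exact: (@initial_continuous _ _ (val : set_type (@simplex_set R 1) -> _)).
exact: coord_continuous.
Qed.

HB.instance Definition _ := isContinuous.Build (simplex R 1) S1 loop_fun loop_continuous.

Definition loop : chain R S1 1 := << (loop_fun : continuousType _ _) >>.

Lemma loop_cycle : loop \in is_cycle R S1.
Proof.
rewrite inE boundary_simplex1 subr_eq0; apply/eqP; congr (<< _ >>).
apply/continuousEP => v /=; rewrite (vertex_eq v).
rewrite (@edge_face0 R 0 erefl) (@edge_face1 R 1 erefl) /loop_fun !mxE /=.
by rewrite sin_pihalf sin0 expr1n expr0n -[1]add0r (pi0Dint 0 1).
Qed.

Lemma wind_loop : wind loop = 1.
Proof.
rewrite /wind fgliftU; transitivity (winding (fun t : R => pi0 (sin t ^+ 2))).
  by congr winding; apply/funext => t /=; rewrite /loop_fun mxE.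
apply: winding_pi0; first exact: sqr_sin_continuous.
by rewrite sin_pihalf sin0 expr1n expr0n add0r.
Qed.

(** Some cycle [z] has a pushforward homologous to the standard loop. Taking winding numbers gives
    [e * wind z = 1], so [e] is a unit of the integers. *)
Lemma degree_H1_bijective (h : continuousType S1 S1) (H : R -> R) (e : int) :
  is_lift H h -> (forall x, H (x + 1) = H x + e%:~R) ->
  bijective (@H1map R _ _ h) -> e = 1 \/ e = -1.
Proof.
move=> Hh H_1 [g _ gK]; pose l : Defs.cycle R S1 := Cycle loop_cycle.
have := gK (\pi_(H1 R S1) l); rewrite -[g _]reprK H1map_pi => /eqP.
set z := repr _; rewrite -Quotient.idealrBE => /is_boundaryP[b bE].
have := wind_boundary b; rewrite bE raddfB /= /wind raddfB /= -/wind -!/(wind _).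
rewrite (wind_push Hh H_1); last exact/eqP/(valP z).
rewrite wind_loop => /eqP; rewrite subr_eq0 => /eqP ez.
have /intUnitRing.unitzPl/orP : (wind (val z) : int) * e = 1 by rewrite mulrC.
by case=> /eqP->; [left|right].
Qed.

End Degree.

(** * Expansion and injectivity on the line *)

Section Dynamics.
Variable R : realType.

(** For b > 0, taking n > M / b gives a^n b >= 2^n b >= n b > M. *)
Lemma geometric_bounded_le0 (a b M : R) : 2 <= a -> (forall n, a ^+ n * b <= M) -> b <= 0.
Proof.
move=> a2 aM; rewrite leNgt; apply/negP => b0.
pose n := (Num.truncn (M / b)).+1.
have : M / b < n%:R by exact: truncnS_gt.
rewrite ltr_pdivrMr// ltNge => /negP; apply; apply: le_trans (aM n).
rewrite ler_pM2r//; apply: (@le_trans _ _ (2 ^+ n)).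
  by rewrite -natrX ler_nat ltnW// ltn_expl.
by rewrite lerXn2r// nnegrE; lra.
Qed.

Lemma periodic_bounded (D : R -> R) : continuous D -> (forall x, D (x + 1) = D x) ->
  exists M, forall x, `|D x| <= M.
Proof.
move=> Dc D1; have [|c _ cM] := @EVT_max R (fun x => `|D x|) 0 1 ler01.
  apply: continuous_subspaceT => x.
  by apply: continuous_comp; [exact: Dc|exact: norm_continuous].
exists `|D c| => x; have -> : D x = D (x - (Num.floor x)%:~R).
  (* Periodicity is the case of degree 0, which allows a shift by any integer. *)
  have := @degree_int R D 0 _ (x - (Num.floor x)%:~R) (Num.floor x).
  by rewrite subrK mul0r addr0; apply=> y; rewrite addr0.
apply: cM; rewrite in_itv/= subr_ge0 ge_floor /= lerBlDr addrC.
by rewrite -intrD1 ltW// floorD1_gt.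
Qed.

Lemma bounded_expanded_eq0 (F D : R -> R) (a M : R) : 2 <= `|a| ->
  (forall x, `|D x| <= M) -> (forall x, D (F x) = a * D x) -> forall x, D x = 0.
Proof.
move=> a2 DM DF x; apply/eqP; rewrite -normr_eq0 eq_le normr_ge0 andbT.
apply: geometric_bounded_le0 a2 _ => n; suff <- : `|D (iter n F x)| = `|a| ^+ n * `|D x|.
  exact: DM.
elim: n => [|n IH]; first by rewrite mul1r.
by rewrite iterS DF normrM IH exprS mulrA.
Qed.

(** For x <= y, a^n (K x - K y) = K (G^n x) - K (G^n y) is at most G^n x - G^n y + 2M, hence at most
    2M for every n. *)
Lemma expanded_homo (G K : R -> R) (a M : R) : 2 <= a ->
  (forall x, `|K x - x| <= M) -> (forall x, K (G x) = a * K x) ->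
  {homo G : x y / x <= y} -> {homo K : x y / x <= y}.
Proof.
move=> a2 KM KG Gh x y xy; rewrite -subr_le0.
apply: (@geometric_bounded_le0 a _ (M + M)) => // n.
have itK u : a ^+ n * K u = K (iter n G u).
  elim: n => [|n IH]; first by rewrite mul1r.
  by rewrite iterS KG -IH exprS mulrA.
have : iter n G x <= iter n G y by elim: n {itK} => //= n; exact: Gh.
rewrite mulrBr !itK; have := KM (iter n G x); have := KM (iter n G y).
by rewrite !ler_norml => /andP[? ?] /andP[? ?] ?; lra.
Qed.

(** If F a = F b with a < b, the extrema over [a, b] can only be attained at the endpoints. Then [F]
    is constant there, and an interior point is an extremum after all. *)
Lemma locally_injective_injective (F : R -> R) : continuous F ->
  (forall x, exists2 r : R, 0 < r & {in `[x - r, x + r] &, injective F}) ->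
  injective F.
Proof.
move=> Fc Floc.
(* Near a point where it is injective, hence strictly monotone, F has no extremum. *)
have interior x a b (s : R) : s = 1 \/ s = -1 -> a < x < b ->
    ~ (forall t, t \in `[a, b] -> s * F t <= s * F x).
  move=> s1 /andP[ax xb] ext; have [r r0 Finj] := Floc x.
  (* The points x - q and x + q stay both in [a, b] and in the interval of injectivity. *)
  pose q := Num.min r (Num.min (x - a) (b - x)).
  have q0 : 0 < q by rewrite !lt_min r0 !subr_gt0 ax xb.
  have qr : q <= r by rewrite ge_min lexx.
  have qa : q <= x - a by rewrite !ge_min lexx orbT.
  have qb : q <= b - x by rewrite !ge_min lexx !orbT.
  have [] := @itv_continuous_inj_mono R F `[x - r, x + r].
  - exact: continuous_subspaceT.
  - exact: Finj.
  - move=> mono.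
    have e1 : F x < F (x + q) by apply: mono; rewrite ?in_itv/=; lra.
    have e2 : F (x - q) < F x by apply: mono; rewrite ?in_itv/=; lra.
    have := ext (x + q); have := ext (x - q); rewrite !in_itv/=.
    move=> /(_ ltac:(lra)) ? /(_ ltac:(lra)) ?; case: s1 => ?; subst s; lra.
  - move=> mono.
    have e1 : F (x + q) < F x by apply: mono; rewrite ?in_itv/=; lra.
    have e2 : F x < F (x - q) by apply: mono; rewrite ?in_itv/=; lra.
    have := ext (x + q); have := ext (x - q); rewrite !in_itv/=.
    move=> /(_ ltac:(lra)) ? /(_ ltac:(lra)) ?; case: s1 => ?; subst s; lra.
have no_eq a b : a < b -> F a <> F b.
  move=> ab Fab; have Fcab : {within `[a, b], continuous F} by exact: continuous_subspaceT.
  have [c cab cM] := EVT_max (ltW ab) Fcab.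
  have [c' cab' cm] := EVT_min (ltW ab) Fcab.
  (* The sign [s] treats maxima (1) and minima (-1) together. *)
  have endpoint x (s : R) : s = 1 \/ s = -1 -> x \in `[a, b] ->
      (forall t, t \in `[a, b] -> s * F t <= s * F x) -> F x = F a.
    move=> s1 xab ext; case: (eqVneq x a) => [->//|xa].
    case: (eqVneq x b) => [->//|xb]; exfalso; apply: (interior x a b s s1 _ ext).
    by move: xab; rewrite in_itv/= !lt_neqAle eq_sym xa xb.
  have Fca : F c = F a.
    by apply: (endpoint c 1) => //; [left|move=> t tab; rewrite !mul1r; exact: cM].
  have Fca' : F c' = F a.
    by apply: (endpoint c' (-1)) => //; [right|move=> t tab; rewrite !mulN1r lerN2; exact: cm].
  apply: (interior ((a + b) / 2) a b 1); [by left|by apply/andP; split; lra|].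
  move=> t tab; rewrite !mul1r (le_trans (cM t tab))// Fca -Fca' cm// in_itv/=.
  by apply/andP; split; lra.
by move=> x y; case: (ltgtP x y) => // /no_eq // ne /esym.
Qed.

End Dynamics.

(** * Semiconjugacies to the power map *)

Section Semiconjugacies.
Variable R : realType.

(** Near [x], [pi0] takes values in one sheet, on which [f] is injective, and [pi0] is itself
    injective on short intervals. So [F] is locally injective. *)
Lemma covering_lift_injective (f : circle R -> circle R) (F : R -> R) :
  covering_map f -> is_lift F f -> injective F.
Proof.
move=> [fc fcov] [Fc Ff]; apply: locally_injective_injective => // x.
have [U [_ Ux [V [VU _ Vhomeo]]]] := fcov (f (pi0 x)).
have [A VA Ax] : (\bigcup_(A in V) A) (pi0 x) by rewrite VU.
have [Aopen [_ _ [q [_ _ fK _]]]] := Vhomeo A VA.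
have : nbhs x (@pi0 R @^-1` A) by apply: pi0_continuous; exact: open_nbhs_nbhs.
move=> /nbhs_ballP[r /= r0 rA].
(* The bound r/2 puts the closed interval inside the ball of radius r; the bound 1/4 keeps two of
   its points less than 1 apart. *)
pose s := Num.min (r / 2) (1 / 4).
have s0 : 0 < s by rewrite lt_min !divr_gt0.
have sr : s <= r / 2 by rewrite ge_min lexx.
have s4 : s <= 1 / 4 by rewrite ge_min lexx orbT.
exists s => // u v; rewrite !in_itv/= => /andP[u1 u2] /andP[v1 v2] Fuv.
have inA w : x - s <= w -> w <= x + s -> pi0 w \in A.
  move=> w1 w2; apply/mem_set/rA; rewrite /ball/=.
  by apply/real_ltr_normlP; rewrite ?num_real//; split; lra.
have [k kE] : exists k : int, u = v + k%:~R.
  apply: pi0_eq; rewrite -[LHS](fK _ (inA u u1 u2)) -[RHS](fK _ (inA v v1 v2)).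
  by rewrite -!Ff Fuv.
have : (k < 1) && (-1 < k) by rewrite -!(ltr_int R); apply/andP; split; lra.
by case/andP; case: k kE => [[|n]|[|n]] // -> _ _; rewrite addr0.
Qed.

Lemma semiconjugacy_lift (d : int) (f h : continuousType (circle R) (circle R)) :
  has_degree f d -> semiconjugacy f (power_map d) h ->
  exists F H (e : int), [/\ is_lift F f, is_lift H h, e = 1 \/ e = -1,
    forall x, H (x + 1) = H x + e%:~R & forall x, H (F x) = d%:~R * H x].
Proof.
move=> [F0 [[F0c F0f] _]] [hf hH1].
have hpi : continuous (h \o @pi0 R).
  by move=> x; apply: continuous_comp; [exact: pi0_continuous|exact: cts_fun].
have [H Hc Hh] := @pi0_lifting R R^o (h \o @pi0 R) hpi.
have shift_cont (a : R) (G : R -> R) : continuous G -> continuous (fun x => G (x + a)).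
  move=> Gc x; apply: (@continuous_comp _ _ _ (fun x => x + a)); last exact: Gc.
  by apply: cvgD; [exact: cvg_id|exact: cvg_cst].
have [e H1] : exists e : int, forall x, H (x + 1) = H x + e%:~R.
  apply: lift_difference => // [|x]; first exact: shift_cont.
  by rewrite !Hh /= -[1]/(1%:~R) pi0Dint.
have e1 : e = 1 \/ e = -1 by exact: (@degree_H1_bijective R h H).
(* Both sides lift h f pi_0 = m_d h pi_0. *)
have [k HF0] : exists k : int, forall x, H (F0 x) = d%:~R * H x + k%:~R.
  apply: lift_difference => [x|x|x].
  - by apply: continuous_comp; [exact: F0c|exact: Hc].
  - by apply: cvgM; [exact: cvg_cst|exact: Hc].
  - by rewrite Hh /= F0f hf -power_map_pi0 Hh.
(* Shifting [F0] by -e k changes [H \o F0] by -e^2 k = -k. *)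
exists (fun x => F0 x + (- (e * k))%:~R), H, e; split => //.
- split=> x; first by apply: cvgD; [exact: F0c|exact: cvg_cst].
  by rewrite pi0Dint.
- move=> x; rewrite (degree_int H1) HF0 -addrA -intrD.
  have -> : k + e * - (e * k) = 0 by case: e1 => ->; ring.
  by rewrite addr0.
Qed.

Lemma covering_semiconjugacy_monotone (d : int)
    (f h : continuousType (circle R) (circle R)) : 1 < `|d| ->
  has_degree f d -> covering_map f -> semiconjugacy f (power_map d) h ->
  monotone_circle_map h.
Proof.
move=> d1 hf fcov /(semiconjugacy_lift hf)[F [H [e [Ff Hh e1 H1 HF]]]].
have Finj := covering_lift_injective fcov Ff.
have Fc := Ff.1; have Hc := Hh.1.
(* [F] is strictly monotone but may reverse the order; its square preserves it. *)
have G_homo : {homo F \o F : x y / x <= y}.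
  have [] := @itv_continuous_inj_mono R F `]-oo, +oo[.
  - exact: continuous_subspaceT.
  - by move=> x y _ _; exact: Finj.
  - move=> mono x y; rewrite le_eqVlt => /orP[/eqP->//|xy] /=.
    by apply/ltW/mono; rewrite ?in_itv//; apply: mono; rewrite ?in_itv.
  - move=> mono x y; rewrite le_eqVlt => /orP[/eqP->//|xy] /=.
    by apply/ltW/mono; rewrite ?in_itv//; apply: mono; rewrite ?in_itv.
have ee : (e%:~R * e%:~R : R) = 1 by case: e1 => ->; ring.
(* As e^2 = 1, [K] commutes with x -> x + 1, so K - id is periodic. *)
pose K x := e%:~R * H x.
have [M KM] : exists M, forall x, `|K x - x| <= M.
  apply: (@periodic_bounded R (fun x => K x - x)) => x.
    by apply: cvgB; [apply: cvgM; [exact: cvg_cst|exact: Hc]|exact: cvg_id].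
  by rewrite /K H1 mulrDr ee; ring.
have K_homo : {homo K : x y / x <= y}.
  apply: (@expanded_homo R (F \o F) K (d%:~R ^+ 2) M) => //.
    have : 2 <= `|d|%:~R :> R by rewrite -[2]/(2%:~R) ler_int.
    by rewrite intr_norm -real_normK ?num_real// => ?; nra.
  by move=> x; rewrite /K /= !HF; ring.
exists H; split => //; case: e1 => eE; [left|right] => x y xy.
  by have := K_homo _ _ xy; rewrite /K eE !mul1r.
by have := K_homo _ _ xy; rewrite /K eE mulrN1z !mulN1r lerN2.
Qed.

(** The map z -> z^e exp(-2 pi i k). Since [e] is an integer, the choice of angle is immaterial. *)
Definition affine_circle (e : int) (k : R) (z : circle R) : circle R :=
  pi0 (e%:~R * angle z - k).

Lemma affine_circle_pi0 e k x : affine_circle e k (pi0 x) = pi0 (e%:~R * x - k).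
Proof.
have [j jE] := lift_angle (erefl (pi0 x)).
by rewrite [in RHS]jE mulrDr -intrM addrAC pi0Dint.
Qed.

(** Continuity cannot be read off [angle]. For e = 1 or -1, cos (e t) = cos t and sin (e t) = e sin
    t, so the addition formulas express the image in the coordinates of [z]. *)
Lemma affine_circle_continuous e k : e = 1 \/ e = -1 -> continuous (affine_circle e k).
Proof.
move=> e1.
have ang z : 2 * pi * (e%:~R * angle z - k) = e%:~R * (2 * pi * angle z) - 2 * pi * k.
  by ring.
have re z : circle_re z = cos (2 * pi * angle z) by rewrite -{1}(angleK z).
have im z : circle_im z = sin (2 * pi * angle z) by rewrite -{1}(angleK z).
have cosE z : cos (e%:~R * (2 * pi * angle z)) = circle_re z.
  by case: e1 => ->; rewrite ?mulrN1z ?mulN1r ?mul1r ?cosN re.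
have sinE z : sin (e%:~R * (2 * pi * angle z)) = e%:~R * circle_im z.
  by case: e1 => ->; rewrite ?mulrN1z ?mulN1r ?mul1r ?sinN im.
have re_c := @circle_re_continuous R.
have eim_c : continuous (fun z => e%:~R * circle_im z : R).
  by move=> z; exact: (cvgM (cvg_cst _) (@circle_im_continuous R z)).
apply: circle_valued_continuous.
- have -> : circle_re (R:=R) \o affine_circle e k = fun z =>
      circle_re z * cos (2 * pi * k) + e%:~R * circle_im z * sin (2 * pi * k).
    by apply/funext => z; rewrite /circle_re /= ang cosB cosE sinE.
  move=> z; exact: (cvgD (cvgM (re_c z) (cvg_cst _)) (cvgM (eim_c z) (cvg_cst _))).
- have -> : circle_im (R:=R) \o affine_circle e k = fun z =>
      e%:~R * circle_im z * cos (2 * pi * k) - circle_re z * sin (2 * pi * k).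
    by apply/funext => z; rewrite /circle_im /= ang sinB cosE sinE.
  move=> z; exact: (cvgB (cvgM (eim_c z) (cvg_cst _)) (cvgM (re_c z) (cvg_cst _))).
Qed.

Lemma affine_circle_homeomorphism e k : e = 1 \/ e = -1 -> homeomorphism (affine_circle e k).
Proof.
move=> e1; split; first exact: affine_circle_continuous.
have ee : (e%:~R * e%:~R : R) = 1 by case: e1 => ->; ring.
(* Solving y = e x - k with e^2 = 1 gives x = e y + e k. *)
exists (affine_circle e (- (e%:~R * k))); split; first exact: affine_circle_continuous.
- move=> z; have [x <-] := pi0_surj z; rewrite !affine_circle_pi0; congr pi0.
  by transitivity (e%:~R * e%:~R * x); [ring|rewrite ee mul1r].
- move=> z; have [x <-] := pi0_surj z; rewrite !affine_circle_pi0; congr pi0.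
  by transitivity (e%:~R * e%:~R * (x + k) - k); [ring|rewrite ee; ring].
Qed.

(** [H 0] and [H 1] differ by 1, so some integer translate of [y] lies between them and is a value
    of [H]. *)
Lemma semiconjugacy_surjective (h : circle R -> circle R) (H : R -> R) (e : int) :
  is_lift H h -> (forall x, H (x + 1) = H x + e%:~R) -> e = 1 \/ e = -1 ->
  forall z, exists w, h w = z.
Proof.
move=> [Hc Hh] H1 e1 z; have [y <-] := pi0_surj z.
have ee : e * e = 1 by case: e1 => ->.
pose k := Num.floor (y - Num.min (H 0) (H 1)).
have [||c _ cE] := @IVT R H 0 1 (y - k%:~R) ler01.
- exact: continuous_subspaceT.
- have l1 : k%:~R <= y - Num.min (H 0) (H 1) by exact: ge_floor.
  have l2 : y - Num.min (H 0) (H 1) < k%:~R + 1 by rewrite -intrD1 floorD1_gt.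
  have maxE : Num.max (H 0) (H 1) = Num.min (H 0) (H 1) + 1.
    have := H1 0; rewrite add0r => ->; case: e1 => ->.
      by rewrite mulr1z max_r ?min_l ?lerDl.
    by rewrite mulrN1z max_l ?min_r ?gerDl ?lerN10// subrK.
  by rewrite maxE; apply/andP; split; lra.
- exists (pi0 c); rewrite -Hh cE; have := pi0Dint y (- k); by rewrite mulrNz.
Qed.

(** The lifts of [f] attached to [h1] and [h2] may differ by an integer [m]. The constant [k]
    absorbs it: D = H1 - e H2 + k is periodic and satisfies D F1 = d D, hence vanishes. *)
Lemma semiconjugacies_differ_affinely (d : int)
    (f h1 h2 : continuousType (circle R) (circle R)) : 1 < `|d| ->
  has_degree f d -> semiconjugacy f (power_map d) h1 ->
  semiconjugacy f (power_map d) h2 ->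
  exists e k, [/\ e = 1 \/ e = -1, self_conjugacy d (affine_circle e k) &
    forall z, h1 z = affine_circle e k (h2 z)].
Proof.
move=> d1 hf /(semiconjugacy_lift hf)[F1 [H1 [e1 [F1f H1h e1E H1p H1F]]]].
move=> /(semiconjugacy_lift hf)[F2 [H2 [e2 [F2f H2h e2E H2p H2F]]]].
have [m Fm] := lift_difference F2f.1 F1f.1 (fun x => etrans (F2f.2 x) (esym (F1f.2 x))).
pose e := e1 * e2.
have eE : e = 1 \/ e = -1 by rewrite /e; case: e1E e2E => -> [] ->; [left|right|right|left].
have ee2 : (e%:~R * e2%:~R : R) = e1%:~R.
  by rewrite -intrM /e -mulrA; case: e2E => ->; rewrite ?mulr1 ?mulrNN ?mulr1.
have d0 : (d%:~R - 1 : R) != 0.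
  by rewrite subr_eq0 -[1]/(1%:~R) eqr_int; apply: contraTneq d1 => ->.
(* Comparing constants in D F1 = d D gives e1 m + k = d k. *)
pose k := (e1 * m)%:~R / (d%:~R - 1) : R.
have kE : d%:~R * k - k = (e1 * m)%:~R.
  by transitivity (k * (d%:~R - 1)); [ring|rewrite /k divfK].
have H2F1 x : H2 (F1 x) = d%:~R * H2 x - (e2 * m)%:~R.
  have -> : F1 x = F2 x + (- m)%:~R by rewrite Fm mulrNz addrK.
  by rewrite (degree_int H2p) H2F mulrN mulrNz.
pose D x := H1 x - e%:~R * H2 x + k.
have Dc : continuous D.
  move=> x; apply: cvgD; last exact: cvg_cst.
  by apply: cvgB; [exact: H1h.1|apply: cvgM; [exact: cvg_cst|exact: H2h.1]].
have D1 x : D (x + 1) = D x by rewrite /D H1p H2p mulrDr ee2; ring.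
have [M DM] := periodic_bounded Dc D1.
have D0 : forall x, D x = 0.
  apply: (@bounded_expanded_eq0 R F1 D d%:~R M) => // [|x].
    by rewrite -intr_norm -[2]/(2%:~R) ler_int.
  rewrite /D H1F H2F1 intrM mulrBr mulrA mulrA ee2.
  move: kE; rewrite intrM => kE.
  have -> : e1%:~R * m%:~R = d%:~R * k - k :> R by [].
  by ring.
have H12 x : H1 x = e%:~R * H2 x - k.
  by apply/eqP; rewrite eq_sym -subr_eq0 -oppr_eq0 -(D0 x) /D; apply/eqP; ring.
exists e, k; split => //; last first.
  move=> z; have [x <-] := pi0_surj z.
  by rewrite -H1h.2 -H2h.2 affine_circle_pi0 H12.
split; first exact: affine_circle_homeomorphism.
move=> z; have [x <-] := pi0_surj z.
rewrite power_map_pi0 !affine_circle_pi0 power_map_pi0.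
(* The angles e d x - k and d (e x - k) differ by (d - 1) k, which is the integer e1 m. *)
rewrite -(pi0Dint (d%:~R * (e%:~R * x - k)) (e1 * m)) -kE; congr pi0; ring.
Qed.

End Semiconjugacies.

Theorem proposition1 (R : realType) (d : int)
    (f : continuousType (circle R) (circle R))
    (hd : 1 < `|d|) (hf : has_degree f d) :
  (forall h : continuousType (circle R) (circle R),
     semiconjugacy f (power_map d) h ->
     exists F, is_lift F f /\
       exists H, [/\ Hplus H \/ Hminus H, T_op d F H = H & quotient_map H h])
  /\ (covering_map f ->
      forall h : continuousType (circle R) (circle R),
        semiconjugacy f (power_map d) h -> monotone_circle_map h)
  /\ (forall h1 h2 : continuousType (circle R) (circle R),
        semiconjugacy f (power_map d) h1 ->
        semiconjugacy f (power_map d) h2 ->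
        exists! c : circle R -> circle R,
          self_conjugacy d c /\ (forall z, h1 z = c (h2 z))).
Proof.
split; [|split] => [h|fcov h|h1 h2 sc1 sc2].
- move=> /(semiconjugacy_lift hf)[F [H [e [Ff [Hc Hh] e1 H1 HF]]]].
  exists F; split => //; exists H; split => //.
  + case: e1 H1 => -> H1; [left|right]; (split; first exact: Hc) => x; exact: H1.
  + have d0 : d%:~R != 0 :> R by rewrite intr_eq0; apply: contraTneq hd => ->.
    by apply/funext => x; rewrite /T_op HF mulrC mulKf.
- exact: covering_semiconjugacy_monotone.
- have [e [k [_ cc h12]]] := semiconjugacies_differ_affinely hd hf sc1 sc2.
  exists (affine_circle e k); split => // c [_ h12']; apply/funext => z.
  (* Surjectivity of [h2] determines [c] from h1 = c h2. *)
  have [F [H [e2 [_ Hh e2E H1 _]]]] := semiconjugacy_lift hf sc2.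
  have [w <-] := semiconjugacy_surjective Hh H1 e2E z.
  by rewrite -h12 -h12'.
Qed.
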